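(* For every integer $n\ge 5$, the coefficient of $t^{-n+3}$ in the Jones polynomial $V_{W(3,n)}(t)$ is $$v_{-n+3}=(-1)^{n-1}\left(\frac{n(n-1)(n-2)}{6}+n\right),$$ so the third twist number of $W(3,n)$ is $$T_3(W(3,n))=|v_{-n+3}|+|v_{n-3}|=\frac{n(n-1)(n-2)}{3}+2n,$$ where $v_i$ denotes the coefficient of $t^i$ in $V_{W(3,n)}(t)$.
   Context: $B_3$ denotes the braid group on three strands with standard generators $\sigma_1,\sigma_2$. $W(3,n)$ is the weaving knot (or link, if $3\mid n$) obtained as the closure of the braid $(\sigma_1\sigma_2^{-1})^n\in B_3$, with all strands oriented in the same direction along the braid. $V_K(t)$ denotes the Jones polynomial, normalized by $V_{\text{unknot}}(t)=1$ and satisfying the skein relation $t^{-1}V_{L_+}-tV_{L_-}=(t^{1/2}-t^{-1/2})V_{L_0}$. If $V_K(t)=\lambda_{-m}t^{-m}+\lambda_{-m+1}t^{-m+1}+\cdots+\lambda_{r-1}t^{r-1}+\lambda_r t^r$ with $\lambda_{-m}\neq 0$ and $\lambda_r\ne 0$, then the $j$th twist number of $K$ is $T_j(K)=|\lambda_{-m+j}|+|\lambda_{r-j}|$. For $K=W(3,n)$ the Jones polynomial has lowest exponent $-n$ and highest exponent $n$ (i.e. $m=r=n$). *)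

(* Defs.v *)
From HB Require Import structures.
From mathcomp Require Import all_boot all_order all_algebra.
From mathcomp Require Import finmap.
From mathcomp Require Import monalg.

Set Implicit Arguments.
Unset Strict Implicit.
Unset Printing Implicit Defensive.

Import Order.TTheory GRing.Theory Num.Theory.

Local Open Scope ring_scope.

(** * The ring Z[t^(1/2), t^(-1/2)] *)

(* Exponents are counted in half-units: the index k : int stands for t^(k/2).
   The library only makes {malg R[K]} a ring when no nontrivial element of the
   exponent monoid K is invertible, which excludes K = int; the product is
   therefore defined here, on an alias of the underlying Z-module. *)
Definition laurent : Type := {malg int[int]}.

HB.instance Definition _ := GRing.Zmodule.on laurent.

Section LaurentRing.
Local Open Scope fset_scope.
Implicit Types (f g h : laurent).

Definition laurent_mul f g : laurent :=
  \sum_(i <- msupp f) \sum_(j <- msupp g) << f@_i * g@_j *g (i + j)%R >>.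

Definition laurent_one : laurent := << 1 *g 0%R >>.

Lemma laurent_mulw (d1 d2 : {fset int}) f g :
    msupp f `<=` d1 -> msupp g `<=` d2 ->
  laurent_mul f g
    = \sum_(i <- d1) \sum_(j <- d2) << f@_i * g@_j *g (i + j)%R >>.
Proof.
move=> le1 le2; rewrite /laurent_mul (big_fset_incl _ le1) /=; last first.
  by move=> i _ /mcoeff_outdom fi; rewrite big1 // => j _; rewrite fi mul0r monalgU0.
apply: eq_bigr => i _; apply: big_fset_incl => // j _ /mcoeff_outdom ->.
by rewrite mulr0 monalgU0.
Qed.

Lemma laurent_mulC : commutative laurent_mul.
Proof.
move=> f g; rewrite /laurent_mul exchange_big /=.
by apply: eq_bigr => i _; apply: eq_bigr => j _; rewrite mulrC addrC.
Qed.

Lemma laurent_mulDl : left_distributive laurent_mul +%R.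
Proof.
move=> f g h.
rewrite (laurent_mulw (msuppD_le f g) (fsubset_refl _)).
rewrite (laurent_mulw (fsubsetUl _ (msupp g)) (fsubset_refl (msupp h))).
rewrite (laurent_mulw (fsubsetUr (msupp f) _) (fsubset_refl (msupp h))).
rewrite -big_split /=; apply: eq_bigr => i _.
rewrite -big_split /=; apply: eq_bigr => j _.
by rewrite mcoeffD mulrDl monalgUD.
Qed.

Lemma laurent_mulDr : right_distributive laurent_mul +%R.
Proof. by move=> f g h; rewrite laurent_mulC laurent_mulDl !(laurent_mulC _ f). Qed.

Lemma laurent_mul0 f : laurent_mul 0 f = 0.
Proof. by rewrite /laurent_mul msupp0 big_seq_fset0. Qed.

Lemma laurent_mulUU (a b i j : int) :
  laurent_mul << a *g i >> << b *g j >> = << a * b *g (i + j)%R >>.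
Proof.
by rewrite (laurent_mulw msuppU_le msuppU_le) !big_seq_fset1 !mcoeffUU.
Qed.

Lemma laurent_mul1 : left_id laurent_one laurent_mul.
Proof.
move=> f; rewrite (laurent_mulw msuppU_le (fsubset_refl _)) big_seq_fset1.
by rewrite [RHS]monalgE; apply: eq_bigr => i _; rewrite mcoeffUU mul1r add0r.
Qed.

Lemma laurent_suml (I : Type) (r : seq I) (F : I -> laurent) g :
  laurent_mul (\sum_(i <- r) F i) g = \sum_(i <- r) laurent_mul (F i) g.
Proof.
apply: (big_morph (fun f => laurent_mul f g)); last exact: laurent_mul0.
by move=> f1 f2; rewrite laurent_mulDl.
Qed.

Lemma laurent_mulA : associative laurent_mul.
Proof.
have sumr I (r : seq I) (F : I -> laurent) g :
    laurent_mul g (\sum_(i <- r) F i) = \sum_(i <- r) laurent_mul g (F i).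
  by rewrite laurent_mulC laurent_suml; apply: eq_bigr => i _; rewrite laurent_mulC.
move: laurent_suml sumr laurent_mulUU; move: laurent_mul => m suml sumr mulUU f g h.
rewrite (monalgE f) (monalgE g) (monalgE h) !suml; apply: eq_bigr => i _.
rewrite sumr [X in _ = m X _]sumr suml; apply: eq_bigr => j _.
by rewrite !sumr; apply: eq_bigr => k _; rewrite !mulUU mulrA addrA.
Qed.

Lemma laurent_one_neq0 : laurent_one != 0.
Proof. by rewrite monalgU_eq0. Qed.

End LaurentRing.

HB.instance Definition _ := GRing.Zmodule_isComNzRing.Build laurent
  laurent_mulA laurent_mulC laurent_mul1 laurent_mulDl laurent_one_neq0.

(* t^(k/2) *)
Definition thalf (k : int) : laurent := << 1 *g k >>.

(* the coefficient of t^i *)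
Definition tcoef (f : laurent) (i : int) : int := mcoeff (2 * i) f.

(* Lowest and highest exponents of a nonzero f, in half-units. *)
Definition lowest (f : laurent) : int :=
  let s := msupp f : seq int in \big[Order.min/head 0 s]_(k <- s) k.
Definition highest (f : laurent) : int :=
  let s := msupp f : seq int in \big[Order.max/head 0 s]_(k <- s) k.

(** * Braids and oriented links *)

(* Letters of words for the braid group on p.+1 strands:
   (i, true) is the standard generator sigma_(i+1), (i, false) its inverse. *)
Definition braid_letter (p : nat) : Type := ('I_p * bool)%type.
Definition braid_word (p : nat) : Type := seq (braid_letter p).

Definition sigma (p : nat) (i : 'I_p) : braid_letter p := (i, true).
Definition letter_inv (p : nat) (x : braid_letter p) : braid_letter p :=
  (x.1, ~~ x.2).

(* Artin's presentation: two words are related iff they represent the same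
   element of the braid group on p.+1 strands. *)
Inductive braid_eq (p : nat) : braid_word p -> braid_word p -> Prop :=
| BraidRefl u : braid_eq u u
| BraidSym u v : braid_eq u v -> braid_eq v u
| BraidTrans u v w : braid_eq u v -> braid_eq v w -> braid_eq u w
| BraidCancel u v x : braid_eq (u ++ [:: x; letter_inv x] ++ v) (u ++ v)
| BraidFar u v (i j : 'I_p) : (i.+1 < j)%N ->
    braid_eq (u ++ [:: sigma i; sigma j] ++ v) (u ++ [:: sigma j; sigma i] ++ v)
| BraidYB u v (i j : 'I_p) : (i.+1 == j)%N ->
    braid_eq (u ++ [:: sigma i; sigma j; sigma i] ++ v)
             (u ++ [:: sigma j; sigma i; sigma j] ++ v).

(* Oriented links are given as closures of braids, with all strands oriented
   along the braid; by Alexander's theorem every oriented link arises so. *)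
Definition closed_braid : Type := {p : nat & braid_word p}.
Definition closure (p : nat) (w : braid_word p) : closed_braid :=
  existT braid_word p w.

(* Adds one strand on the right. *)
Definition widen_word (p : nat) (w : braid_word p) : braid_word p.+1 :=
  [seq (widen_ord (leqnSn p) x.1, x.2) | x <- w].

(* Isotopy of oriented links, in the form given by Markov's theorem. *)
Inductive isotopic : closed_braid -> closed_braid -> Prop :=
| IsoSym K L : isotopic K L -> isotopic L K
| IsoTrans K L M : isotopic K L -> isotopic L M -> isotopic K M
| IsoBraid p (u v : braid_word p) :
    braid_eq u v -> isotopic (closure u) (closure v)
| IsoConj p (u : braid_word p) (x : braid_letter p) :
    isotopic (closure (x :: u ++ [:: letter_inv x])) (closure u)
| IsoStab p (u : braid_word p) (e : bool) :
    isotopic (closure (rcons (widen_word u) (ord_max, e))) (closure u).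

Definition unknot : closed_braid := @closure 0 [::].

(* L_+, L_-, L_0 agree except near one crossing, which is positive in L_+,
   negative in L_- and smoothed along the orientation in L_0; the generators
   sigma_i are taken to be positive crossings. *)
Inductive skein_triple : closed_braid -> closed_braid -> closed_braid -> Prop :=
| SkeinTriple p (u v : braid_word p) (i : 'I_p) :
    skein_triple (closure (u ++ sigma i :: v))
                 (closure (u ++ letter_inv (sigma i) :: v))
                 (closure (u ++ v)).

(** * The Jones polynomial *)

(* The Jones polynomial is the unique V satisfying this predicate. *)
Record is_jones_polynomial (V : closed_braid -> laurent) : Prop := {
  jones_isotopic : forall K L, isotopic K L -> V K = V L;
  jones_unknot : V unknot = 1;
  jones_skein : forall Lp Lm L0, skein_triple Lp Lm L0 ->
    thalf (- 2) * V Lp - thalf 2 * V Lm = (thalf 1 - thalf (- 1)) * V L0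
}.

(* |lambda_(-m+j)| + |lambda_(r-j)| where -m and r are the extreme exponents
   of t in V K; the shift by j in powers of t is a shift by 2j half-units. *)
Definition twist_number (V : closed_braid -> laurent) (j : nat)
    (K : closed_braid) : int :=
  `|mcoeff (lowest (V K) + 2 * j%:Z) (V K)|
  + `|mcoeff (highest (V K) - 2 * j%:Z) (V K)|.

(* W(3,n), the closure of (sigma_1 sigma_2^-1)^n on three strands *)
Definition weaving3 (n : nat) : closed_braid :=
  @closure 2 (flatten (nseq n [:: sigma ord0; letter_inv (sigma ord_max)])).

(* Main.v *)
Require Import Defs.
From mathcomp Require Import all_boot all_order all_algebra.
From mathcomp Require Import finmap monalg ring zify.

(* For a fixed V, the values of V on closures of 3-braids form a functional on
   the Hecke algebra of B_3.  There s1 s2^-1 acts with characteristic roots 1,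
   1 and the eigenvalues of its Burau matrix, whose determinant is 1 and whose
   trace is x = 1 - t - t^-1; so V (W(3,n)) obeys a linear recurrence of order
   three, and three initial values give V (W(3,n)) = t + t^-1 + tr (M^n), M
   being the Burau matrix.  The traces satisfy
   tr (M^(n+2)) = x tr (M^(n+1)) - tr (M^n), from which the lowest coefficients
   are read off by induction; they are symmetric under t <-> t^-1. *)

Import Order.TTheory GRing.Theory Num.Theory.
Local Open Scope ring_scope.

(** * Monomials and cancellation in the Laurent ring *)

Lemma mcoeff_thalfM (i k : int) (f : laurent) :
  mcoeff k (thalf i * f) = mcoeff (k - i) f.
Proof.
have -> : thalf i * f = \sum_(j <- msupp f) << mcoeff j f *g i + j >>.
  rewrite [LHS](laurent_mulw msuppU_le (fsubset_refl _)) big_seq_fset1.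
  by apply: eq_bigr => j _; rewrite mcoeffUU mul1r.
rewrite [in RHS](monalgE f) !raddf_sum; apply: eq_bigr => j _ /=.
by rewrite !mcoeffU eq_sym [in RHS]eq_sym subr_eq addrC.
Qed.

Lemma thalfD (i j : int) : thalf (i + j) = thalf i * thalf j.
Proof. by rewrite [RHS]laurent_mulUU mulr1. Qed.

Lemma thalfVr (i : int) : thalf i * thalf (- i) = 1.
Proof. by rewrite -thalfD subrr. Qed.

(** A vanishing product makes the coefficients of [f] periodic with period 2, which finite support
    allows only for [f = 0]. *)
Lemma thalf_sub_lreg (f : laurent) :
  (thalf 1 - thalf (- 1)) * f = 0 -> f = 0.
Proof.
move=> zf0; apply/eqP; apply: contraT => fN0.
have shift k : mcoeff k f = mcoeff (k + 2) f.
  have /eqP := congr1 (mcoeff (k + 1)) zf0.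
  rewrite mulrBl mcoeffB !mcoeff_thalfM mcoeff0 subr_eq0 => /eqP.
  by rewrite addrK opprK -addrA.
have shiftn k n : mcoeff k f = mcoeff (k + n%:Z *+ 2) f.
  elim: n => [|n ->]; first by rewrite mul0rn addr0.
  by rewrite [LHS]shift; congr (mcoeff _ f); lia.
have [k] : exists k, k \in msupp f.
  apply/fset0Pn; apply: contraNneq fN0 => f0.
  by rewrite [f]monalgE f0 big_seq_fset0.
rewrite -mcoeff_neq0 => fk.
have bounded : forall s : seq int, exists n : nat, {in s, forall j, j < n%:Z}.
  elim=> [|j s [n ns]]; first by exists 0%N.
  exists (maxn n `|j|.+1) => i; rewrite inE => /orP[/eqP->|/ns]; lia.
have [n nP] := bounded (msupp f).
have := nP (k + (n + `|k|)%N%:Z *+ 2).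
by rewrite -mcoeff_neq0 -shiftn => /(_ fk); lia.
Qed.

Lemma thalf_sub_inj :
  injective (fun f : laurent => (thalf 1 - thalf (- 1)) * f).
Proof.
move=> f g /= /eqP; rewrite -subr_eq0 -mulrBr => /eqP/thalf_sub_lreg/eqP.
by rewrite subr_eq0 => /eqP.
Qed.

(** * Functionals on the Hecke algebra of B_3 *)

Local Notation s1 := (sigma (ord0 : 'I_2)).
Local Notation s2 := (sigma (ord_max : 'I_2)).

(** The relations of the Hecke algebra, [s^2 = p + k s], [p s^-1 = s - k] and the braid relation,
    imposed on values of [F] in every context. *)
Definition hecke_functional {R : comNzRingType} (p k : R)
    (F : braid_word 2 -> R) : Prop :=
  [/\ forall u v i, F (u ++ [:: sigma i, sigma i & v])
                      = p * F (u ++ v) + k * F (u ++ sigma i :: v),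
      forall u v i, p * F (u ++ letter_inv (sigma i) :: v)
                      = F (u ++ sigma i :: v) - k * F (u ++ v)
    & forall u v, F (u ++ [:: s1, s2, s1 & v]) = F (u ++ [:: s2, s1, s2 & v])].

Lemma hecke_functional_cons {R : comNzRingType} {p k : R} {F} x :
  hecke_functional p k F -> hecke_functional p k (fun w => F (x :: w)).
Proof.
case=> sq inv yb; split=> u v *; first exact: (sq (x :: u)).
  exact: (inv (x :: u)).
exact: (yb (x :: u)).
Qed.

(* The values of F on the products b w, for b in the standard basis
   1, s1, s2, s1 s2, s2 s1, s1 s2 s1 of the Hecke algebra.  The actions below
   are written in these coordinates, with q inverse to p. *)
Definition hecke_coords {R : comNzRingType} (F : braid_word 2 -> R) w :=
  (F w, F (s1 :: w), F (s2 :: w), F [:: s1, s2 & w], F [:: s2, s1 & w],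
   F [:: s1, s2, s1 & w]).

Definition sigma1_act {R : comNzRingType} (p k : R)
    (X : R * R * R * R * R * R) :=
  let: (x, x1, x2, x12, x21, x121) := X in
  (x1, p * x + k * x1, x12, p * x2 + k * x12, x121, p * x21 + k * x121).

Definition sigma2V_act {R : comNzRingType} (p q k : R)
    (X : R * R * R * R * R * R) :=
  let: (x, x1, x2, x12, x21, x121) := X in
  (q * (x2 - k * x), q * (x21 - k * x1), x, q * (x121 - k * x12), x1, x12).

Lemma hecke_coords_sigma1 {R : comNzRingType} {p k : R} {F} w :
    hecke_functional p k F ->
  hecke_coords (fun w => F (s1 :: w)) w = sigma1_act p k (hecke_coords F w).
Proof. by case=> sq _ _; rewrite /hecke_coords /= !(sq [::]). Qed.

Lemma hecke_coords_sigma2V {R : comNzRingType} {p q k : R} {F} w :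
    p * q = 1 -> hecke_functional p k F ->
  hecke_coords (fun w => F (letter_inv s2 :: w)) w
    = sigma2V_act p q k (hecke_coords F w).
Proof.
move=> pq1 [sq inv yb].
have inv2 v : F (letter_inv s2 :: v) = q * (F (s2 :: v) - k * F v).
  by rewrite -(inv [::]) mulrA [q * p]mulrC pq1 mul1r.
have sq2 v : F [:: s2, s2 & v] = p * F v + k * F (s2 :: v) by exact: (sq [::]).
have cancel v : q * (F [:: s2, s2 & v] - k * F (s2 :: v)) = F v.
  by rewrite sq2; ring: pq1.
have yb2 v : F [:: s2, s1, s2 & v] = F [:: s1, s2, s1 & v].
  by rewrite -(yb [::]).
(* With the braid relation, [s2^-1 s1 s2 s1 = s2^-1 s2 s1 s2 = s1 s2], which gives the last
   coordinate. *)
have yb22 v : F [:: s2, s1, s2, s1 & v] = F [:: s2, s2, s1, s2 & v].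
  exact: (yb [:: s2]).
rewrite /sigma2V_act /hecke_coords !inv2 yb22.
by rewrite -[in k * F [:: s1, s2, s1 & w]]yb2 !cancel yb2.
Qed.

Lemma hecke_coords_weave {R : comNzRingType} {p q k : R} {F} w :
    p * q = 1 -> hecke_functional p k F ->
  hecke_coords (fun w => F [:: s1, letter_inv s2 & w]) w
    = sigma2V_act p q k (sigma1_act p k (hecke_coords F w)).
Proof.
move=> pq1 hF; rewrite -(hecke_coords_sigma1 _ hF).
exact: (hecke_coords_sigma2V w pq1 (hecke_functional_cons s1 hF)).
Qed.

Local Notation weave n :=
  (flatten (nseq n [:: s1; letter_inv s2])) (only parsing).

Lemma hecke_functional_weave {R : comNzRingType} {p k : R} {F} :
  hecke_functional p k F ->
  hecke_functional p k (fun w => F [:: s1, letter_inv s2 & w]).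
Proof.
by move=> /(hecke_functional_cons s1)/(hecke_functional_cons (letter_inv s2)).
Qed.

(** In the induction the outermost factor [s1 s2^-1] is absorbed into [F], so [w] stays fixed and
    one linear map is iterated. *)
Lemma hecke_coords_weave_iter {R : comNzRingType} {p q k : R} {F} n w :
    p * q = 1 -> hecke_functional p k F ->
  hecke_coords (fun w => F (weave n ++ w)) w
    = iter n (fun X => sigma2V_act p q k (sigma1_act p k X)) (hecke_coords F w).
Proof.
move=> pq1; elim: n F => [//|n IHn] F hF; rewrite iterSr.
by rewrite -(hecke_coords_weave _ pq1 hF) -(IHn _ (hecke_functional_weave hF)).
Qed.

(* This is (m - 1) (m^2 - x m + 1) = 0 for m = s1 s2^-1, with
   x = - 1 - k^2 / p. *)
Lemma hecke_weave_cubic {R : comNzRingType} {p q k : R} {F} w :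
    p * q = 1 -> hecke_functional p k F ->
  F (weave 3 ++ w)
    = F w - k ^+ 2 * q * (F (weave 2 ++ w) - F (weave 1 ++ w)).
Proof.
move=> pq1 hF.
pose act X := sigma2V_act p q k (sigma1_act p k X).
(* The first coordinate belongs to the basis element 1, so it is the value of [F] itself. *)
have coord0 n :
    F (weave n ++ w) = (iter n act (hecke_coords F w)).1.1.1.1.1.
  by rewrite -(hecke_coords_weave_iter _ _ pq1 hF).
by rewrite !coord0 /act /sigma1_act /sigma2V_act /=; ring: pq1.
Qed.

(* The trace of M^n for a 2 x 2 matrix M of trace x and determinant 1. *)
Fixpoint lucas {R : comNzRingType} (x : R) (n : nat) : R :=
  match n with
  | 0 => 2
  | m.+1 => if m is l.+1 then x * lucas x m - lucas x l else x
  end.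

Lemma lucasSS {R : comNzRingType} (x : R) n :
  lucas x n.+2 = x * lucas x n.+1 - lucas x n.
Proof. by []. Qed.

(** * Jones polynomials of closed 3-braids *)

Local Notation J V w := (V (Defs.closure w)) (only parsing).
Local Notation z := (thalf 2 * (thalf 1 - thalf (- 1))).
Local Notation delta := (- (thalf 1 + thalf (- 1))).

Lemma jones_skein_word {V} (hV : is_jones_polynomial V) {p}
    (u v : braid_word p) i :
  thalf 4 * J V (u ++ letter_inv (sigma i) :: v)
    = J V (u ++ sigma i :: v) - z * J V (u ++ v).
Proof.
have := jones_skein hV (SkeinTriple u v i); have := thalfVr 2.
have -> : thalf 4 = thalf 2 * thalf 2 := thalfD 2 2.
move: (thalf 2) (thalf (- 2)) (thalf 1 - _ : laurent) => t tV c ttV.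
move: (J V _) (J V _) (J V _) => J0 Jm Jp sk.
by rewrite -[LHS]mulrA -[t * c * J0]mulrA -sk; ring: ttV.
Qed.

Lemma jones_hecke {V} (hV : is_jones_polynomial V) :
  hecke_functional (thalf 4) z (fun w : braid_word 2 => J V w).
Proof.
split=> [u v i|u v i|u v]; [|exact: (jones_skein_word hV)|].
  (* The skein relation at the first of two equal letters: its negative version cancels against the
     second. *)
  have := jones_skein_word hV u (sigma i :: v) i.
  have -> : J V (u ++ letter_inv (sigma i) :: sigma i :: v) = J V (u ++ v).
    exact/(jones_isotopic hV)/IsoBraid/(BraidCancel u v (letter_inv (sigma i))).
  by move=> ->; rewrite subrK.
exact/(jones_isotopic hV)/IsoBraid/BraidYB.
Qed.

Lemma jones_stab {V} (hV : is_jones_polynomial V) {p} (u : braid_word p) e :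
  J V (rcons (widen_word u) (ord_max, e)) = J V u.
Proof. exact/(jones_isotopic hV)/IsoStab. Qed.

(** A crossing between the last strand of [u] and the new strand is a stabilization for either sign.
    The skein relation there gives [t^-1 - t] times the value at [u], which factors as
    [t^(1/2) - t^(-1/2)] times [delta]. *)
Lemma jones_split {V} (hV : is_jones_polynomial V) {p} (u : braid_word p) :
  J V (widen_word u) = delta * J V u.
Proof.
have := jones_skein hV (SkeinTriple (widen_word u) [::] ord_max).
rewrite /letter_inv !cats1 !(jones_stab hV) cats0 -mulrBl => sk.
apply: thalf_sub_inj; rewrite -sk mulrA.
rewrite -[thalf (- 2)]/(thalf (- 1 + - 1)) -[thalf 2]/(thalf (1 + 1)) !thalfD.
ring.
Qed.

Lemma jones_braid {V} (hV : is_jones_polynomial V) {p}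
    {u v : braid_word p} :
  braid_eq u v -> J V u = J V v.
Proof. by move=> uv; apply/(jones_isotopic hV)/IsoBraid. Qed.

Lemma jones_conj {V} (hV : is_jones_polynomial V) {p} (u : braid_word p) x :
  J V (x :: u ++ [:: letter_inv x]) = J V u.
Proof. exact/(jones_isotopic hV)/IsoConj. Qed.

Lemma jones_rot {V} (hV : is_jones_polynomial V) {p} (u : braid_word p) x :
  J V (rcons u x) = J V (x :: u).
Proof.
rewrite -(jones_conj hV (rcons u x) x) -cats1 -catA.
by rewrite (jones_braid hV (BraidCancel (x :: u) [::] x)) cats0.
Qed.

Lemma jones_unlink3 {V} (hV : is_jones_polynomial V) :
  J V ([::] : braid_word 2) = delta ^+ 2.
Proof.
rewrite -[[::]]/(widen_word (widen_word ([::] : braid_word 0))).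
by rewrite !(jones_split hV) (jones_unknot hV) mulr1.
Qed.

Lemma jones_sigma1 {V} (hV : is_jones_polynomial V) (e : bool) :
  J V [:: (ord0 : 'I_1, e)] = 1.
Proof.
rewrite (_ : [:: _] = rcons (widen_word ([::] : braid_word 0)) (ord_max, e)).
  by rewrite (jones_stab hV) (jones_unknot hV).
by congr [:: (_, _)]; apply: val_inj.
Qed.

(** The closures of the basis elements are the unlinks with three and two components, the unknot
    and, for [s1 s2 s1], the Hopf link. *)
Lemma jones_coords {V} (hV : is_jones_polynomial V) :
  hecke_coords (fun w : braid_word 2 => J V w) [::]
    = (delta ^+ 2, delta, delta, 1, 1, thalf 4 * delta + z).
Proof.
have [sq _ _] := jones_hecke hV.
have w1 : [:: s1] = widen_word [:: sigma (ord0 : 'I_1)].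
  by congr [:: (_, _)]; apply: val_inj.
have J1 : J V [:: s1] = delta.
  by rewrite w1 (jones_split hV) (jones_sigma1 hV) mulr1.
have J2 : J V [:: s2] = delta.
  rewrite -[[:: _]]/(rcons (widen_word [::]) (ord_max, true)) (jones_stab hV).
  rewrite -[[::]]/(widen_word ([::] : braid_word 0)) (jones_split hV).
  by rewrite (jones_unknot hV) mulr1.
have J12 : J V [:: s1; s2] = 1.
  rewrite -[[:: s1; s2]]/(rcons [:: s1] s2) w1 (jones_stab hV).
  by rewrite (jones_sigma1 hV).
have J21 : J V [:: s2; s1] = 1.
  by rewrite -[[:: s2; s1]]/(rcons [:: s2] s1) (jones_rot hV).
rewrite /hecke_coords J1 J2 J12 J21 (jones_unlink3 hV).
(* Rotation gives [s1 s1 s2], to which the quadratic relation applies. *)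
rewrite -[[:: s1; s2; s1]]/(rcons [:: s1; s2] s1) (jones_rot hV).
by rewrite (sq [::]) /= J2 J12 mulr1.
Qed.

Local Notation burau_trace := (1 - thalf 2 - thalf (- 2)).

Lemma jones_weave {V} (hV : is_jones_polynomial V) n :
  J V (weave n) = thalf 2 + thalf (- 2) + lucas burau_trace n.
Proof.
have pq1 := thalfVr 4; have ab1 := thalfVr 1.
have t2 : thalf 2 = thalf 1 * thalf 1 := thalfD 1 1.
have t2V : thalf (- 2) = thalf (- 1) * thalf (- 1) := thalfD (- 1) (- 1).
have t4 : thalf 4 = thalf 2 * thalf 2 := thalfD 2 2.
have t4V : thalf (- 4) = thalf (- 2) * thalf (- 2) := thalfD (- 2) (- 2).
have coord0 m := congr1 (fun X => X.1.1.1.1.1)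
   (hecke_coords_weave_iter m [::] pq1 (jones_hecke hV)).
rewrite (jones_coords hV) in coord0.
have J0 m : J V (weave m ++ [::]) = _ := coord0 m.
(* The recurrence has order three, so three consecutive values are carried. *)
pose P m := J V (weave m) = thalf 2 + thalf (- 2) + lucas burau_trace m.
suff [] : [/\ P n, P n.+1 & P n.+2] by [].
rewrite {}/P; elim: n => [|n [IH0 IH1 IH2]].
  (* Initial values: the three-component unlink, the unknot and the figure-eight knot. *)
  rewrite -[weave 0]cats0 -[weave 1]cats0 -[weave 2]cats0.
  rewrite !J0 /sigma1_act /sigma2V_act /= t4 t4V t2 t2V.
  split; ring: ab1.
split=> //.
(* The summand [t + t^-1] is constant in [n] and accounts for the root 1; the traces account for the
   quadratic factor. *)
have := hecke_weave_cubic (weave n) pq1 (jones_hecke hV).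
rewrite -[weave 3 ++ _]/(weave n.+3) -[weave 2 ++ _]/(weave n.+2).
rewrite -[weave 1 ++ _]/(weave n.+1) => ->; rewrite IH0 IH1 IH2 !lucasSS.
move: (lucas _ n) (lucas _ n.+1) => x y.
rewrite t4V t2 t2V; ring: ab1.
Qed.

(** * Coefficients of the traces *)

Lemma mcoeff_thalf i k : mcoeff k (thalf i) = (i == k)%:R.
Proof. exact: mcoeffU. Qed.

Lemma mcoeff_burau_traceM (f : laurent) k :
  mcoeff k (burau_trace * f) = mcoeff k f - mcoeff (k - 2) f - mcoeff (k + 2) f.
Proof. by rewrite !mulrBl mul1r !mcoeffB !mcoeff_thalfM opprK. Qed.

Local Notation c n k := (mcoeff k (lucas burau_trace n)).

Lemma mcoeff_lucasSS n (k : int) :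
  c n.+2 k = c n.+1 k - c n.+1 (k - 2) - c n.+1 (k + 2) - c n k.
Proof. by rewrite lucasSS mcoeffB mcoeff_burau_traceM. Qed.

Lemma mcoeff_lucas0 k : c 0 k = (k == 0)%:R *+ 2.
Proof. by rewrite mulr2n mcoeffD -[1]/(thalf 0) mcoeff_thalf eq_sym. Qed.

Lemma mcoeff_lucas1 k : c 1 k = (k == 0)%:R - (k == 2)%:R - (k == - 2)%:R.
Proof.
by rewrite !mcoeffB -[1]/(thalf 0) !mcoeff_thalf !(eq_sym _ k).
Qed.

Lemma mcoeff_lucasN n k : c n (- k) = c n k.
Proof.
suff [] : (forall k, c n (- k) = c n k)
       /\ (forall k, c n.+1 (- k) = c n.+1 k) by [].
elim: n {k} => [|n [IH0 IH1]].
  split=> k; rewrite ?mcoeff_lucas0 ?mcoeff_lucas1 !eqr_oppLR ?oppr0 //.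
  by rewrite opprK addrAC.
split=> // k; rewrite !mcoeff_lucasSS IH0 IH1 -[- k - 2]opprD IH1.
have -> : - k + 2 = - (k - 2) by lia.
by rewrite IH1 [_ - c n.+1 (k + 2) - _]addrAC.
Qed.

(** Each step multiplies by [x], whose lowest term is [- t^-1], so the lowest exponent drops by at
    most 2 half-units. *)
Lemma mcoeff_lucas_low n k : k < - (2 * n%:Z) -> c n k = 0.
Proof.
suff [] : (forall k, k < - (2 * n%:Z) -> c n k = 0)
       /\ (forall k, k < - (2 * n.+1%:Z) -> c n.+1 k = 0) by move=> /(_ k).
elim: n {k} => [|n [IH0 IH1]].
  split=> k ltk; first by rewrite mcoeff_lucas0 lt_eqF.
  by rewrite mcoeff_lucas1 !lt_eqF //; lia.
split=> // k ltk; rewrite mcoeff_lucasSS !IH1 ?IH0 ?subr0 //; lia.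
Qed.

(* The third equation fails for c 1, since c 1 2 = - 1. *)
Lemma mcoeff_lucas_first n :
  [/\ c n.+2 (- (2 * n.+2%:Z)) = (- 1) ^+ n,
      c n.+2 (- (2 * n.+2%:Z) + 2) = - (- 1) ^+ n * n.+2%:Z,
      c n.+2 (- (2 * n.+2%:Z) + 4) = (- 1) ^+ n * 'C(n.+2, 2)%:Z
    & c n.+2 (- (2 * n.+2%:Z) + 6) = - (- 1) ^+ n * ('C(n.+2, 3) + n.+2)%N%:Z].
Proof.
pose P m e := [/\ c m (- (2 * m%:Z)) = e, c m (- (2 * m%:Z) + 2) = - e * m%:Z,
  c m (- (2 * m%:Z) + 4) = e * 'C(m, 2)%:Z
  & c m (- (2 * m%:Z) + 6) = - e * ('C(m, 3) + m)%N%:Z].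
suff [] : P n.+2 ((- 1) ^+ n) /\ P n.+3 (- (- 1) ^+ n) by [].
elim: n => [|n [[e0 e1 e2 e3] [f0 f1 f2 f3]]].
  split; first by split; rewrite mcoeff_lucasSS !mcoeff_lucas1 mcoeff_lucas0.
  split; rewrite mcoeff_lucasSS (mcoeff_lucasSS 0) (mcoeff_lucasSS 0);
    by rewrite (mcoeff_lucasSS 0) !mcoeff_lucas1 !mcoeff_lucas0.
split; first by rewrite exprS mulN1r.
rewrite exprS mulN1r opprK.
move: ((- 1) ^+ n) e0 e1 e2 e3 f0 f1 f2 f3 => e e0 e1 e2 e3 f0 f1 f2 f3.
have shift (x y : int) m : x = y -> c m x = c m y by move->.
have low : c n.+3 (- (2 * n.+4%:Z)) = 0 by apply: mcoeff_lucas_low; lia.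
have low' : c n.+3 (- (2 * n.+4%:Z) - 2) = 0 by apply: mcoeff_lucas_low; lia.
have low2 : c n.+2 (- (2 * n.+4%:Z)) = 0 by apply: mcoeff_lucas_low; lia.
have low2' : c n.+2 (- (2 * n.+4%:Z) + 2) = 0 by apply: mcoeff_lucas_low; lia.
split; rewrite mcoeff_lucasSS.
- rewrite low low' low2 (shift _ (- (2 * n.+3%:Z))) ?f0; last lia.
  ring.
- rewrite (shift (_ + 2 - 2) (- (2 * n.+4%:Z))) ?low ?low2'; last lia.
  rewrite (shift (_ + 2 + 2) (- (2 * n.+3%:Z) + 2)) ?f1; last lia.
  rewrite (shift (_ + 2) (- (2 * n.+3%:Z))) ?f0; last lia.
  ring.
- rewrite (shift (_ + 4 + 2) (- (2 * n.+3%:Z) + 4)) ?f2; last lia.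
  rewrite (shift (_ + 4 - 2) (- (2 * n.+3%:Z))) ?f0; last lia.
  rewrite (shift (_ + 4) (- (2 * n.+3%:Z) + 2)) ?f1; last lia.
  rewrite (shift (_ + 4) (- (2 * n.+2%:Z))) ?e0; last lia.
  (* The terms from [f0] and [e0] cancel; Pascal's rule matches the rest. *)
  rewrite [in RHS]binS bin1 PoszD; ring.
- rewrite (shift (_ + 6 + 2) (- (2 * n.+3%:Z) + 6)) ?f3; last lia.
  rewrite (shift (_ + 6 - 2) (- (2 * n.+3%:Z) + 2)) ?f1; last lia.
  rewrite (shift (_ + 6) (- (2 * n.+3%:Z) + 4)) ?f2; last lia.
  rewrite (shift (_ + 6) (- (2 * n.+2%:Z) + 2)) ?e1; last lia.
  (* Besides Pascal's rule, the linear terms add up to [2 (n + 3) - (n + 2) = n + 4]. *)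
  rewrite [in RHS]binS !PoszD; ring.
Qed.

(** * Extreme exponents and the twist number *)

Lemma head_mem (T : eqType) (x0 x : T) s : x \in s -> head x0 s \in s.
Proof. by case: s => //= y s _; exact: mem_head. Qed.

Lemma lowest_eq (f : laurent) m :
  mcoeff m f != 0 -> (forall k, k < m -> mcoeff k f = 0) -> lowest f = m.
Proof.
rewrite mcoeff_neq0 => mf min_m; rewrite /lowest.
have le_m k : k \in msupp f -> m <= k.
  by rewrite -mcoeff_neq0 leNgt; apply: contra => /min_m ->.
apply/eqP; rewrite eq_le; apply/andP; split.
  exact: (@bigmin_inf_seq _ _ _ _ _ m).
(* The default of the minimum is the head of the support, which is a genuine exponent because [m] is
   in the support. *)
rewrite big_seq; apply: le_bigmin => //; apply: le_m.
exact: head_mem mf.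
Qed.

Lemma highest_eq (f : laurent) m :
  mcoeff m f != 0 -> (forall k, m < k -> mcoeff k f = 0) -> highest f = m.
Proof.
rewrite mcoeff_neq0 => mf max_m; rewrite /highest.
have le_m k : k \in msupp f -> k <= m.
  by rewrite -mcoeff_neq0 leNgt; apply: contra => /max_m ->.
apply/eqP; rewrite eq_le; apply/andP; split; last first.
  exact: (@bigmax_sup_seq _ _ _ _ _ m).
rewrite big_seq; apply: bigmax_le => //; apply: le_m.
exact: head_mem mf.
Qed.

Lemma bin3_rat n :
  ('C(n, 3)%:R : rat) = n%:R * (n%:R - 1) * (n%:R - 2) / 6%:R.
Proof.
elim: n => [|n IHn]; first by rewrite !mul0r.
have b2 : ('C(n, 2)%:R : rat) = n%:R * (n%:R - 1) / 2%:R.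
  elim: n {IHn} => [|n IHn]; first by rewrite !mul0r.
  by rewrite binS natrD IHn bin1 -natr1; field.
by rewrite binS natrD IHn b2 -natr1; field.
Qed.

Theorem theorem5p2 (V : closed_braid -> laurent) (hV : is_jones_polynomial V)
    (n : nat) (hn : (5 <= n)%N) :
  let v (i : int) : int := tcoef (V (weaving3 n)) i in
  let N : rat := n%:R in
  [/\ (v (- n%:Z + 3))%:~R
        = (-1) ^+ n.-1 * (N * (N - 1) * (N - 2) / 6%:R + N) :> rat,
      twist_number V 3 (weaving3 n) = `|v (- n%:Z + 3)| + `|v (n%:Z - 3)|
    & (twist_number V 3 (weaving3 n))%:~R
        = N * (N - 1) * (N - 2) / 3%:R + 2%:R * N :> rat].
Proof.
move=> v N; rewrite {}/v /twist_number /tcoef /weaving3 (jones_weave hV).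
set f := thalf 2 + _ + _.
(* The summand [t + t^-1] only touches the half-unit exponents 2 and -2. The exponents [2 (n - 3)]
   and [- 2 (n - 3)] avoid them since [n >= 5]. *)
have fE k : 2 < `|k| -> mcoeff k f = c n k.
  move=> k2; rewrite !mcoeffD !mcoeff_thalf.
  have -> : (2 == k) = false by lia.
  have -> : (- 2 == k) = false by lia.
  by rewrite !add0r.
have [fst0 fst3] : c n (- (2 * n%:Z)) = (- 1) ^+ n
    /\ c n (- (2 * n%:Z) + 6) = (- 1) ^+ n.-1 * ('C(n, 3) + n)%N%:Z.
  case: n hn {f fE N} => [|[|m]] // _.
  have [-> _ _ ->] := mcoeff_lucas_first m.
  by rewrite !exprS !mulN1r opprK.
have lowf : lowest f = - (2 * n%:Z).
  apply: lowest_eq => [|k ltk]; first by rewrite fE ?fst0 ?signr_eq0; lia.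
  by rewrite fE ?mcoeff_lucas_low //; lia.
have highf : highest f = 2 * n%:Z.
  apply: highest_eq => [|k ltk].
    by rewrite fE; [rewrite -mcoeff_lucasN fst0 signr_eq0|lia].
  by rewrite fE; [rewrite -mcoeff_lucasN mcoeff_lucas_low //; lia|lia].
have v3 : mcoeff (2 * (- n%:Z + 3)) f = (- 1) ^+ n.-1 * ('C(n, 3) + n)%N%:Z.
  have -> : 2 * (- n%:Z + 3) = - (2 * n%:Z) + 6 by lia.
  by rewrite fE; [exact: fst3|lia].
have v3' : mcoeff (2 * (n%:Z - 3)) f = (- 1) ^+ n.-1 * ('C(n, 3) + n)%N%:Z.
  (* The symmetry of the traces transfers the low coefficient to the high end. *)
  rewrite fE; last lia; rewrite -mcoeff_lucasN.
  by have -> : - (2 * (n%:Z - 3)) = - (2 * n%:Z) + 6 by lia.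
rewrite lowf highf.
rewrite (_ : - (2 * n%:Z) + 2 * 3%:Z = 2 * (- n%:Z + 3)); last lia.
rewrite (_ : 2 * n%:Z - 2 * 3%:Z = 2 * (n%:Z - 3)); last lia.
have valE : (('C(n, 3) + n)%N%:R : rat) = N * (N - 1) * (N - 2) / 6%:R + N.
  by rewrite natrD bin3_rat.
(* Both coefficients are the same sign times the same natural number, so the twist number is twice
   that number. *)
rewrite v3 v3' normrMsign ger0_norm //; split=> //.
  by rewrite rmorphM rmorphXn rmorphN1 /= -valE.
rewrite rmorphD /= -[(_ %:Z)%:~R]/(_%:R) valE; by field.
Qed.
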